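(* For positive integers $d$ and $n$, the set $\mathcal{S}(d,n) := \{a \in \mathbb{N}^+ : d \preccurlyeq_a n\}$ is either $\mathbb{N}^+$, or an initial interval $\{1,2,\ldots,m\}$ for some $m \in \mathbb{N}^+$, or the empty set. The following trichotomy holds. (i) If $d \mid n$, then $d \preccurlyeq_a n$ for all $a \in \mathbb{N}^+$. (ii) If $d \nmid n$ but $d \preccurlyeq_1 n$, then for $a \in \mathbb{N}^+$, $d \preccurlyeq_a n$ if and only if $a < \dfrac{\lfloor n/d \rfloor}{\delta(d,n)}$, where $\delta(d,n) = n - d\lfloor n/d \rfloor$. (iii) If $d \not\preccurlyeq_1 n$, then $d \not\preccurlyeq_a n$ for all $a \in \mathbb{N}^+$.
   Context: $\mathbb{N}^+ = \{1,2,3,\ldots\}$. For positive integers $d, n$, one writes $d \preccurlyeq_1 n$ if $d = \lfloor n/k \rfloor$ for some positive integer $k$. For an integer $a \ge 1$, one writes $d \preccurlyeq_a n$ (''$d$ is an $a$-floor quotient of $n$'') if and only if $ad \preccurlyeq_1 an$, i.e. there is a positive integer $k$ with $ad = \lfloor an/k \rfloor$. *)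

(* Defs.v *)
From mathcomp Require Import all_boot all_order all_algebra.
From mathcomp Require Import boolp classical_sets.

Set Implicit Arguments.
Unset Strict Implicit.
Unset Printing Implicit Defensive.

(* Positive integers are elements of [nat] with an explicit positivity
   hypothesis; [n %/ k] is the floor of n / k when [0 < k]. *)
Definition floor_quotient (d n : nat) : Prop :=
  exists2 k : nat, (0 < k)%N & d = (n %/ k)%N.

Definition a_floor_quotient (a d n : nat) : Prop :=
  floor_quotient (a * d)%N (a * n)%N.

Definition floor_scaling_set (d n : nat) : set nat :=
  [set a : nat | (0 < a)%N /\ a_floor_quotient a d n]%classic.

(* The truncated subtraction is exact, since [d * (n %/ d) <= n]. *)
Definition delta (d n : nat) : nat := (n - d * (n %/ d))%N.

(* Main.v *)
Require Import Defs.
From mathcomp Require Import all_boot all_order all_algebra.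
From mathcomp Require Import boolp classical_sets.

(** The theorem reduces to a single numerical criterion.  A positive [k]
    satisfies [a d = floor (a n / k)] exactly when [a d k <= a n < (a d + 1) k],
    that is, when [d k <= n] and [a (n - d k) < k].  Increasing [k] subject to
    [d k <= n] decreases the left side of the last inequality and increases the
    right side, so some [k] works if and only if the largest admissible one,
    [k = floor (n / d)], does.  Hence

      d is an a-floor quotient of n   iff   a * delta(d, n) < floor (n / d)

    ([a_floor_quotientE]).  This condition is monotone in [a], so its solutions
    form an initial interval.  If [delta(d, n) = 0], which means [d %| n], the
    condition holds for every [a], since [floor (n / d)] is then positive;
    otherwise it bounds [a] by [floor (n / d) / delta(d, n)].  A failure at
    [a = 1] propagates to all [a]. *)

Lemma delta_modn d n : delta d n = n %% d.
Proof. by rewrite /delta mulnC {1}(divn_eq n d) addKn. Qed.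

Lemma eq_divn_iff m n k : 0 < k -> m = n %/ k <-> m * k <= n < m.+1 * k.
Proof.
move=> k_gt0; rewrite -leq_divRL // -ltn_divLR // ltnS.
by split=> [->|/anti_leq //]; rewrite leqnn.
Qed.

(** The factor [a] cancels from the lower bound on [a n], but not from the
    upper one: this is the source of the dependence on [a]. *)
Lemma scaled_quotient_iff a d n k : 0 < a -> 0 < k ->
  a * d = a * n %/ k <-> (d * k <= n) && (a * (n - d * k) < k).
Proof.
move=> a_gt0 k_gt0; rewrite eq_divn_iff // -mulnA leq_pmul2l //.
have [le_dk_n /=|//] := leqP (d * k) n.
by rewrite mulSn -mulnA mulnBr ltn_subLR ?leq_pmul2l // addnC.
Qed.

(** The multiplier [n %/ d] is the optimal choice of [k]. *)
Lemma a_floor_quotientE a d n : 0 < a -> 0 < d ->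
  a_floor_quotient a d n <-> a * delta d n < n %/ d.
Proof.
move=> a_gt0 d_gt0; split=> [[k k_gt0]|lt_q].
  move/(scaled_quotient_iff _ _ _ _ a_gt0 k_gt0)/andP => [le_dk_n lt_k].
  have le_k_q : k <= n %/ d by rewrite leq_divRL // mulnC.
  apply: leq_trans le_k_q; apply: leq_ltn_trans lt_k.
  by rewrite /delta leq_pmul2l // leq_sub2l // leq_pmul2l // leq_divRL // mulnC.
have q_gt0 : 0 < n %/ d by apply: leq_ltn_trans lt_q.
exists (n %/ d) => //; apply/scaled_quotient_iff => //.
by rewrite lt_q andbT mulnC leq_divM.
Qed.

Lemma floor_quotientE d n : 0 < d ->
  floor_quotient d n <-> delta d n < n %/ d.
Proof.
move=> d_gt0; have := a_floor_quotientE 1 d n isT d_gt0.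
by rewrite /a_floor_quotient !mul1n.
Qed.

Theorem theorem1p5 (d n : nat) (d_gt0 : (0 < d)%N) (n_gt0 : (0 < n)%N) :
  (floor_scaling_set d n = [set a : nat | (0 < a)%N]%classic
   \/ (exists2 m : nat, (0 < m)%N &
         floor_scaling_set d n = [set a : nat | (1 <= a <= m)%N]%classic)
   \/ floor_scaling_set d n = set0%classic)
  /\ ((d %| n)%N -> forall a : nat, (0 < a)%N -> a_floor_quotient a d n)
  /\ (~~ (d %| n)%N -> floor_quotient d n ->
        forall a : nat, (0 < a)%N ->
          (a_floor_quotient a d n <->
             (a%:R < (n %/ d)%N%:R / (delta d n)%:R :> rat)%R))
  /\ (~ floor_quotient d n ->
        forall a : nat, (0 < a)%N -> ~ a_floor_quotient a d n).
Proof.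
have divisible : d %| n -> forall a, 0 < a -> a_floor_quotient a d n.
  move=> d_dvd_n a a_gt0; apply/a_floor_quotientE => //.
  have /eqP -> : delta d n == 0 by rewrite delta_modn.
  by rewrite muln0 divn_gt0 // dvdn_leq.
have delta_gt0 : ~~ (d %| n) -> 0 < delta d n.
  by rewrite delta_modn lt0n.
have not_quotient : ~ floor_quotient d n ->
    forall a, 0 < a -> ~ a_floor_quotient a d n.
  move=> not_fq a a_gt0 /a_floor_quotientE lt_q; apply: not_fq.
  apply/floor_quotientE => //; apply: leq_ltn_trans (lt_q _ _) => //.
  by rewrite leq_pmull.
split; last split=> //; last split=> //.
- have [d_dvd_n|/delta_gt0 dl_gt0] := boolP (d %| n).
    left; apply/seteqP; split=> a /=; first by case.
    by move=> a_gt0; split=> //; apply: divisible.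
  right; have [fq|not_fq] := pselect (floor_quotient d n); last first.
    right; apply/seteqP; split=> a //= [a_gt0 afq].
    exact: not_quotient not_fq _ a_gt0 afq.
  have lt_q : delta d n < n %/ d by apply/floor_quotientE.
  have q_gt0 : 0 < n %/ d by apply: leq_ltn_trans lt_q.
  (* The bound a * delta < q is strict, so the last solution is the quotient
     of q - 1, rather than q, by delta. *)
  left; exists ((n %/ d).-1 %/ delta d n).
    by rewrite divn_gt0 // -ltnS prednK.
  have afqE a : 0 < a ->
      a_floor_quotient a d n <-> a <= (n %/ d).-1 %/ delta d n.
    move=> a_gt0; rewrite a_floor_quotientE // (leq_divRL _ _ dl_gt0).
    by rewrite -{1}(prednK q_gt0) ltnS.
  apply/seteqP; split=> a /=.
    by case=> a_gt0 /(afqE _ a_gt0) le_a; rewrite a_gt0.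
  by case/andP=> a_gt0 le_a; split=> //; apply/afqE.
- move=> /delta_gt0 dl_gt0 _ a a_gt0; rewrite a_floor_quotientE //.
  by rewrite Num.Theory.ltr_pdivlMr ?Num.Theory.ltr0n // -GRing.natrM
    Num.Theory.ltr_nat.
Qed.
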